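(* Let $n,d\in\mathbb{N}$, $\lambda\ge1$ and $\beta\in(0,1]$. If $\mathsf{M}\colon[0,1]\times(\mathcal{S}_d)^n\to\mathcal{S}_d$ is a $(\lambda,\beta)$-estimator of top singular vector and $\mathsf{M}(\gamma,\cdot)$ is $\left(1,\frac{\beta}{4n}\right)$-differentially private for every $\gamma\in[0,1]$, then $$n\ge\Omega\!\left(\frac{\sqrt d/\lambda}{\log^{1.5}\!\left(\frac{d}{\beta\lambda}\right)}\right).$$
   Context: $\mathcal{S}_d=\{v\in\mathbb{R}^d:\|v\|_2=1\}$. An input $(x_1,\dots,x_n)\in(\mathcal{S}_d)^n$ is identified with the $n\times d$ matrix $X$ whose rows are the $x_i$; $\sigma_1(X)\ge\sigma_2(X)\ge\dots$ are its singular values and its top right singular vector $v\in\mathcal{S}_d$ maximizes $\|Xv\|_2$. $\mathsf{M}$ is a $(\lambda,\beta)$-estimator of top singular vector if for every $X\in(\mathcal{S}_d)^n$ and every $\gamma\in[0,1]$ with $\sigma_2(X)\le\gamma\sigma_1(X)$, it outputs $y\in\mathcal{S}_d$ with $\Pr_{y\sim\mathsf{M}(\gamma,X)}[\|Xy\|_2^2\ge\|Xv\|_2^2-\lambda\gamma n]\ge\beta$. A mechanism is $(\varepsilon,\delta)$-differentially private if for every two datasets differing in exactly one row and every output set $T$, $\Pr[\mathsf{M}(X)\in T]\le e^{\varepsilon}\Pr[\mathsf{M}(X')\in T]+\delta$. $\Omega(\cdot)$ hides a positive absolute constant.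
   Formalization: The formal theorem assumes n ≥ 1 and d/(βλ) ≥ 2; without the latter the bound is undefined (d/(βλ) ≤ 1) or false near 1 (d = λ = n = 1, a constant M, β → 1). *)

(* Defs.v *)
From HB Require Import structures.
From mathcomp Require Import all_boot all_order all_algebra.
From mathcomp Require Import all_classical all_reals all_analysis.
From mathcomp Require Import Rstruct Rstruct_topology.
From Stdlib Require Import Rdefinitions.

Set Implicit Arguments.
Unset Strict Implicit.
Unset Printing Implicit Defensive.

Import Order.TTheory GRing.Theory Num.Theory.
Local Open Scope ring_scope.
Local Open Scope classical_set_scope.

Definition vec (d : nat) := 'rV[R]_d.

Definition sqnorm (d : nat) (v : 'rV[R]_d) : R := \sum_(j < d) (v ord0 j) ^+ 2.

Definition sphere (d : nat) : set ('rV[R]_d) := [set v | sqnorm v = 1].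
Arguments sphere d : clear implicits.

Definition sqnormXy (n d : nat) (X : 'M[R]_(n, d)) (y : 'rV[R]_d) : R :=
  \sum_(i < n) (\sum_(j < d) X i j * y ord0 j) ^+ 2.

Definition dataset (n d : nat) (X : 'M[R]_(n, d)) : Prop :=
  forall i : 'I_n, sphere d (row i X).

Definition top_right_sv (n d : nat) (X : 'M[R]_(n, d)) (v : 'rV[R]_d) : Prop :=
  sphere d v /\ forall u, sphere d u -> sqnormXy X u <= sqnormXy X v.

(* Singular values: s is the nonincreasing list of eigenvalues (with
   multiplicity) of X^T X, i.e. the squared singular values; we then set
   sigma_k(X) = sqrt (s`_(k-1)) (with value 0 beyond the list). *)
Definition sq_singular_values (n d : nat) (X : 'M[R]_(n, d)) (s : seq R) : Prop :=
  [/\ size s = d, sorted (fun a b => b <= a) s &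
      char_poly (X^T *m X) = \prod_(a <- s) ('X - a%:P)].

Definition singular_value (n d : nat) (X : 'M[R]_(n, d)) (k : nat) : R :=
  Num.sqrt (nth 0 (xget [::] (sq_singular_values X)) k.-1).

Definition vecB (d : nat) := g_sigma_algebraType (@open ('rV[R]_d)).

Definition mechanism (n d : nat) :=
  R -> 'M[R]_(n, d) -> probability (vecB d) R.

Definition neighbors (n d : nat) (X Y : 'M[R]_(n, d)) : Prop :=
  exists (i : 'I_n), (row i X != row i Y) /\
    forall k : 'I_n, k <> i -> row k X = row k Y.

Definition outputs_on_sphere (n d : nat) (M : mechanism n d) : Prop :=
  forall (g : R) (X : 'M[R]_(n, d)), 0 <= g <= 1 -> dataset X ->
    M g X (sphere d : set (vecB d)) = 1%E.

Definition top_sv_estimator (n d : nat) (lam beta : R) (M : mechanism n d) : Prop :=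
  forall (X : 'M[R]_(n, d)) (g : R) (v : 'rV[R]_d),
    dataset X -> 0 <= g <= 1 ->
    singular_value X 2 <= g * singular_value X 1 ->
    top_right_sv X v ->
    (beta%:E <= M g X ([set y | (sqnormXy X v - lam * g * n%:R <= sqnormXy X y)%R]
                        : set (vecB d)))%E.

Definition diff_private (n d : nat) (eps delta : R) (Mg : 'M[R]_(n, d) -> probability (vecB d) R) : Prop :=
  forall (X Y : 'M[R]_(n, d)), dataset X -> dataset Y -> neighbors X Y ->
    forall T : set (vecB d), measurable T ->
      (Mg X T <= (expR eps)%:E * Mg Y T + delta%:E)%E.
Arguments diff_private n d eps%_ring_scope delta%_ring_scope Mg.

(* Main.v *)
Require Import Defs.
From HB Require Import structures.
From mathcomp Require Import all_boot all_order all_algebra.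
From mathcomp Require Import all_classical all_reals all_analysis.
From mathcomp Require Import measurable_realfun.
From mathcomp Require Import ring lra.
From mathcomp Require Import Rstruct Rstruct_topology.
From Stdlib Require Import Rdefinitions.
Import Order.TTheory GRing.Theory Num.Theory.
Import numFieldNormedType.Exports.
Local Open Scope ring_scope.

(** A fingerprinting argument. The dataset has entries [+-1/sqrt d]; its columns
    are independent and each consists of [n] draws from a Polya urn with initial
    masses [a, a], where [a] is of order [1/lam^2]. Two rows differ on a fraction
    of about [a] of the columns, so with probability at least [1/2] the matrix is
    close enough to rank one for [gamma = 1/(4 lam)] to be admissible, and an
    accurate output correlates with the sum of the rows.

    For the Polya urn the conditional mean of [x_i] given the other rows is
    [(S - x_i) / (n - 1 + 2a)], with [S] the sum of the rows; hence the scores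
    [<y, (n + 2a) x_i - S>] add up to exactly [2a <y, S>]. An accurate output
    therefore gives a large score to some row [i]. By privacy this remains likely
    when row [i] is replaced by a constant row; but then the output is independent
    of [x_i], the score is a sum of independent centred terms, and a large value
    has probability [exp(- Omega(a d / n^2))]. Comparing with [beta / n] bounds
    [n] from below. *)

(** * Traces of a matrix and of its square from the spectrum *)

Lemma trace_sum_roots (F : comNzRingType) (d : nat) (A : 'M[F]_d) (s : seq F) :
  size s = d -> char_poly A = \prod_(a <- s) ('X - a%:P) ->
  \tr A = \sum_(a <- s) a.
Proof.
case: d A => [|d] A szs chA.
  by rewrite (size0nil szs) big_nil /mxtrace big_ord0.
have := @char_poly_trace _ _ A isT; rewrite chA => tr.
have := @coefPn_prod_XsubC _ s; rewrite szs tr => /(_ isT).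
exact: oppr_inj.
Qed.

(** Lets an identity of characteristic polynomials be checked after substituting ['X^2], where the
    determinant belonging to [A *m A] factors. *)
Lemma comp_Xsq_inj (F : idomainType) :
  injective (fun p : {poly F} => p \Po 'X^2).
Proof.
move=> p q /= /eqP; rewrite -subr_eq0 -raddfB /= => /eqP E.
apply/eqP; rewrite -subr_eq0 -size_poly_eq0; apply/eqP.
have /eqP := E; rewrite comp_poly_eq0 ?size_polyXn // => /eqP ->.
exact: size_poly0.
Qed.

(* [det (X^2 - A^2) = det (X - A) * det (X + A)], hence the eigenvalues of [A^2]
   are the squares of those of [A]. *)
Lemma char_poly_sqr (F : idomainType) (d : nat) (A : 'M[F]_d) (s : seq F) :
  size s = d -> char_poly A = \prod_(a <- s) ('X - a%:P) ->
  char_poly (A *m A) = \prod_(a <- [seq a ^+ 2 | a <- s]) ('X - a%:P).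
Proof.
move=> szs chA; apply: comp_Xsq_inj.
have -> : char_poly (A *m A) \Po 'X^2
    = \det (char_poly_mx A) * \det ('X%:M + map_mx polyC A).
  rewrite -det_mulmx /char_poly -det_map_mx; congr (\det _).
  rewrite /char_poly_mx mulmxDr !mulmxBl -!scalar_mxM.
  rewrite (scalar_mxC 'X (map_mx polyC A)) addrA subrK -map_mxM.
  apply/matrixP => i j; rewrite !mxE raddfB /= comp_polyC.
  by rewrite raddfMn /= comp_polyX expr2.
have -> : \det ('X%:M + map_mx polyC A)
    = (-1) ^+ d * (char_poly A \Po (- 'X)).
  rewrite /char_poly -det_map_mx -detZ; congr (\det _).
  apply/matrixP => i j; rewrite !mxE raddfB /= comp_polyC.
  by rewrite raddfMn /= comp_polyX mulN1r opprB mulNrn opprK addrC.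
rewrite -/(char_poly A) chA !rmorph_prod /= -szs big_map.
have -> : (-1) ^+ size s = \prod_(a <- s) (-1) :> {poly F}.
  by rewrite big_const_seq count_predT iter_mulr_1.
rewrite -!big_split /=; apply: eq_bigr => a _.
rewrite !raddfB /= !comp_polyX !comp_polyC rmorphXn /=; ring.
Qed.

Lemma trace_sqr_sum_roots (F : idomainType) (d : nat) (A : 'M[F]_d) (s : seq F) :
  size s = d -> char_poly A = \prod_(a <- s) ('X - a%:P) ->
  \tr (A *m A) = \sum_(a <- s) a ^+ 2.
Proof.
move=> szs chA; rewrite (@trace_sum_roots _ _ _ [seq a ^+ 2 | a <- s]).
- by rewrite big_map.
- by rewrite size_map.
- exact: char_poly_sqr.
Qed.

(** * One column: the Polya urn, its moments and its scores *)

(** Since [(1 - x) * expR x <= 1], it is enough that [1 - x] times the right-hand side, which is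
    [1 + x ^+ 2 * (1 - 2 * x)], is at least 1. *)
Lemma expR_le_quadratic (R : realType) (x : R) :
  x <= 1 / 2 -> expR x <= 1 + x + 2 * x ^+ 2.
Proof.
move=> x_le; have ex := expR_gt0 x.
have : (1 - x) * expR x <= 1.
  rewrite -[leRHS](expRxMexpNx_1 x) mulrC ler_pM2l //.
  exact: expR_ge1Dx.
have x2 := sqr_ge0 x; rewrite expr2 in x2 *.
nra.
Qed.

Definition spin {R : realType} (b : bool) : R := if b then 1 else -1.

Definition colsum {R : realType} {n : nat} (w : {ffun 'I_n -> bool}) : R :=
  \sum_i spin (w i).

Definition rising {R : realType} (a : R) (k : nat) : R := \prod_(l < k) (a + l%:R).

(* Up to normalisation, the law of the first [n] draws from a Polya urn that
   starts with a mass [a] of either colour. *)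
Definition polya {R : realType} {n : nat} (a : R) (w : {ffun 'I_n -> bool}) : R :=
  rising a (\sum_i w i) * rising a (\sum_i ~~ w i).

Definition upd {n : nat} (i : 'I_n) (b : bool) (w : {ffun 'I_n -> bool}) :
  {ffun 'I_n -> bool} := [ffun k => if k == i then b else w k].

Lemma sqr_spin (R : realType) (b : bool) : spin b ^+ 2 = 1 :> R.
Proof. by case: b; rewrite /spin ?sqrrN expr1n. Qed.

Lemma rising_gt0 (R : realType) (a : R) k : 0 < a -> 0 < rising a k.
Proof. by move=> a0; apply: prodr_gt0 => l _; rewrite ltr_wpDr ?ler0n. Qed.

Lemma polya_gt0 (R : realType) n (a : R) (w : {ffun 'I_n -> bool}) :
  0 < a -> 0 < polya a w.
Proof. by move=> a0; rewrite mulr_gt0 // rising_gt0. Qed.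

(** The weight depends only on the colour counts, so draw [i] may be treated as the last one: [p]
    and [m] count the other draws, and the two colours have odds [a + p] to [a + m]. The moment
    identity and the exponential bound both rest on this. *)
Lemma polya_upd (R : realType) n (a : R) (i : 'I_n) (w : {ffun 'I_n -> bool}) :
  0 < a -> exists K p m : R,
  [/\ 0 < K, 0 <= p, 0 <= m, p + m + 1 = n%:R & forall b,
      polya a (upd i b w) = K * (if b then a + p else a + m) /\
      colsum (upd i b w) = spin b + p - m].
Proof.
move=> a0.
pose p : nat := \big[addn/O]_(k | k != i) w k.
pose m : nat := \big[addn/O]_(k | k != i) ~~ w k.
exists (rising a p * rising a m), p%:R, m%:R; split; rewrite ?ler0n //.
- by rewrite mulr_gt0 ?rising_gt0.
- rewrite -natrD natr1; congr (_%:R); rewrite -big_split /=.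
  rewrite (eq_bigr (fun=> S O)) => [|k _]; last by case: (w k).
  rewrite sum1_card; have := cardC1 i; rewrite card_ord => ->.
  by case: n i {w p m} => [[]|].
- move=> b; split.
  + rewrite /polya (bigD1 i) //= [X in rising a X * _]/= ffunE eqxx.
    rewrite [in X in _ * X](bigD1 i) //= ffunE eqxx.
    rewrite (eq_bigr (fun k => w k : nat)); last first.
      by move=> k /negPf ki; rewrite ffunE ki.
    rewrite [in X in _ * X](eq_bigr (fun k => ~~ w k : nat)); last first.
      by move=> k /negPf ki; rewrite ffunE ki.
    rewrite -/p -/m; case: b => /=; rewrite add0n add1n.
      by rewrite {1}/rising big_ord_recr /= -/(rising a p); ring.
    by rewrite {2}/rising big_ord_recr /= -/(rising a m); ring.
  + rewrite /colsum (bigD1 i) //= ffunE eqxx -addrA; congr (_ + _).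
    rewrite /p /m !natr_sum -sumrB; apply: eq_bigr => k /negPf ki.
    by rewrite ffunE ki; case: (w k); rewrite /spin /= ?subr0 ?sub0r.
Qed.

(** Exchanging the new bit [b] with the old value [w i] is an involution on pairs. This allows
    averaging over draw [i] first, the others being fixed. *)
Lemma sum_upd (R : realType) n (i : 'I_n) (G : {ffun 'I_n -> bool} -> R) :
  \sum_w \sum_b G (upd i b w) = 2 * \sum_w G w.
Proof.
rewrite pair_big /=.
pose h (z : {ffun 'I_n -> bool} * bool) := (upd i z.2 z.1, z.1 i).
have hh : involutive h.
  move=> [w b]; rewrite /h /= ffunE eqxx; congr (_, _).
  by apply/ffunP => k; rewrite !ffunE; case: eqP => // ->.
rewrite (reindex_inj (inv_inj hh)) /=.
rewrite (eq_bigr (fun z => G z.1)); last first.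
  move=> [w b] _ /=; congr G.
  by apply/ffunP => k; rewrite !ffunE; case: eqP => // ->.
rewrite -(pair_big xpredT xpredT (fun w (_ : bool) => G w)) /= mulr_sumr.
by apply: eq_bigr => w _; rewrite sumr_const card_bool mulr_natl.
Qed.

Section score.
Context {R : realType} {n : nat}.

(* Proportional to [w i] minus its conditional mean given the other draws. *)
Definition score (a : R) (i : 'I_n) (w : {ffun 'I_n -> bool}) : R :=
  (n%:R + 2 * a) * spin (w i) - colsum w.

(** The conditional variance of the score given the other draws: with [p] and [m] as in [polya_upd]
    it is [4 * (a + p) * (a + m)], independent of [w i]. *)
Definition score_var (a : R) (i : 'I_n) (w : {ffun 'I_n -> bool}) : R :=
  (n%:R - 1 + 2 * a) ^+ 2 - (colsum w - spin (w i)) ^+ 2.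

Lemma sum_score (a : R) (w : {ffun 'I_n -> bool}) : \sum_i score a i w = 2 * a * colsum w.
Proof.
rewrite /score sumrB -mulr_sumr -/(colsum w) sumr_const card_ord -mulr_natl.
ring.
Qed.

(** The score of [i] has conditional mean zero, so it is orthogonal to the sum of the other draws.
    Adding these relations over [i] gives a linear equation for the second moment. *)
Lemma colsum_sqr_mean (a : R) : 0 < a ->
  (1 + 2 * a) * \sum_(w : {ffun 'I_n -> bool}) polya a w * colsum w ^+ 2
  = n%:R * (n%:R + 2 * a) * \sum_(w : {ffun 'I_n -> bool}) polya a w.
Proof.
move=> a0.
have sum0 i :
    \sum_w polya a w * ((colsum w - spin (w i)) * score a i w) = 0.
  apply: (@mulfI _ (2 : R)); first by rewrite pnatr_eq0.
  rewrite -(sum_upd _ _ i) mulr0; apply: big1 => w _.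
  have [K [p [m [K0 p0 m0 pmn Hb]]]] := polya_upd _ _ _ i w a0.
  rewrite big_bool /=.
  rewrite /score (Hb true).1 (Hb true).2 (Hb false).1 (Hb false).2.
  by rewrite !ffunE eqxx -pmn /spin; ring.
have : \sum_(i < n) \sum_w polya a w * ((colsum w - spin (w i)) * score a i w)
    = 0 by apply: big1 => i _.
rewrite exchange_big /= => H; apply/eqP; rewrite -subr_eq0 -[X in _ == X]H.
rewrite !mulr_sumr -sumrB; apply/eqP; apply: eq_bigr => w _.
rewrite -mulr_sumr.
have -> : \sum_i (colsum w - spin (w i)) * score a i w =
    (1 + 2 * a) * colsum w ^+ 2 - n%:R * (n%:R + 2 * a).
  rewrite (eq_bigr (fun i => (n%:R + 2 * a + 1) * colsum w * spin (w i) -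
     (n%:R + 2 * a + colsum w ^+ 2))) => [|i _]; last first.
    by rewrite /score; case: (w i); rewrite /spin; ring.
  rewrite sumrB -mulr_sumr -/(colsum w) sumr_const card_ord -mulr_natl; ring.
by ring.
Qed.

Lemma colsum_gap_mean (a : R) : 0 < a ->
  \sum_(w : {ffun 'I_n -> bool}) polya a w * (n%:R ^+ 2 - colsum w ^+ 2)
  <= 2 * a * n%:R ^+ 2 * \sum_(w : {ffun 'I_n -> bool}) polya a w.
Proof.
move=> a0; have H := colsum_sqr_mean _ a0.
rewrite (eq_bigr (fun w => n%:R ^+ 2 * polya a w - polya a w * colsum w ^+ 2));
  last by move=> w _; ring.
rewrite sumrB -mulr_sumr; move: H.
set Z := \sum_w polya a w; set T := \sum_w _ => H.
have Z0 : 0 <= Z by apply: sumr_ge0 => w _; rewrite ltW // polya_gt0.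
have n0 : 0 <= n%:R :> R by [].
have a1 : 0 < 1 + 2 * a by rewrite addr_gt0 ?mulr_gt0.
rewrite -(ler_pM2l a1) mulrBr H -subr_ge0.
have -> : (1 + 2 * a) * (2 * a * n%:R ^+ 2 * Z) -
  ((1 + 2 * a) * (n%:R ^+ 2 * Z) - n%:R * (n%:R + 2 * a) * Z) =
  4 * a * a * n%:R ^+ 2 * Z + 2 * a * n%:R * Z by ring.
by rewrite addr_ge0 // ?mulr_ge0 // ltW.
Qed.

(** Keeping the conditional variance inside the exponential makes the bound valid whatever the other
    draws are; that variance is controlled later, on good codes only. *)
Lemma score_mgf (a th y : R) (i : 'I_n) (w : {ffun 'I_n -> bool}) :
  0 < a -> `|y| <= 1 -> `|th| * (4 * (n%:R + a)) <= 1 ->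
  \sum_b polya a (upd i b w) *
    expR (th * (y * score a i (upd i b w)) - 2 * th ^+ 2 * score_var a i (upd i b w))
  <= \sum_b polya a (upd i b w).
Proof.
move=> a0 y1 th1.
have [K [p [m [K0 p0 m0 pmn Hb]]]] := polya_upd _ _ _ i w a0.
have us b : score a i (upd i b w) = if b then 2 * (a + m) else - (2 * (a + p)).
  by rewrite /score (Hb b).2 ffunE eqxx -pmn; case: b; rewrite /spin; ring.
have vs b : score_var a i (upd i b w) = 4 * (a + p) * (a + m).
  by rewrite /score_var (Hb b).2 ffunE eqxx -pmn; case: b; rewrite /spin; ring.
rewrite !big_bool /= !us !vs (Hb true).1 (Hb false).1 !exp.expRD.
set v := 4 * _ * _; set E := expR (- _).
(* Brings both exponents into the range of [expR_le_quadratic]. *)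
have bnd (t : R) : 0 <= t -> t <= n%:R + a -> th * y * (2 * t) <= 1 / 2 /\
    th * y * (- (2 * t)) <= 1 / 2.
  move=> t0 tn.
  have : `|th * y * (4 * t)| <= 1.
    apply: le_trans th1; rewrite !normrM -mulrA ler_wpM2l //.
    have -> : `|4| = 4 :> R by rewrite ger0_norm.
    rewrite (ger0_norm t0) -[X in _ <= X]mul1r ler_pM ?mulr_ge0 //.
    by rewrite ler_wpM2l.
  rewrite ler_norml => /andP[h1 h2].
  have e1 : th * y * (4 * t) = 2 * (th * y * (2 * t)) by ring.
  have e2 : th * y * (- (2 * t)) = - (th * y * (2 * t)) by ring.
  by rewrite e2; rewrite e1 in h1 h2; split; lra.
have am : 0 <= a + m by rewrite addr_ge0 // ltW.
have ap : 0 <= a + p by rewrite addr_ge0 // ltW.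
have [b1 _] : _ /\ _ := bnd (a + m) am ltac:(lra).
have [_ b2] : _ /\ _ := bnd (a + p) ap ltac:(lra).
have e1 := expR_le_quadratic _ _ b1; have e2 := expR_le_quadratic _ _ b2.
have v0 : 0 <= v by rewrite /v !mulr_ge0.
have EV : E * (1 + 2 * th ^+ 2 * v) <= 1.
  rewrite -[leRHS](expRxMexpNx_1 (2 * th ^+ 2 * v)) mulrC.
  by apply: ler_wpM2r; [exact: expR_ge0 | exact: expR_ge1Dx].
have yy : y ^+ 2 <= 1 by rewrite -[y ^+ 2]real_normK ?num_real // expr_le1.
have E0 : 0 < E := expR_gt0 _.
(* The weights [a + p] and [a + m] cancel the linear terms; the quadratic terms add up to
   [2 * th ^+ 2 * y ^+ 2 * v] times the total weight. *)
have S1 : (a + p) * expR (th * y * (2 * (a + m))) +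
          (a + m) * expR (th * y * (- (2 * (a + p)))) <=
          (2 * a + p + m) * (1 + 2 * th ^+ 2 * v).
  apply: (le_trans (lerD (ler_wpM2l ap e1) (ler_wpM2l am e2))).
  rewrite -subr_ge0 [leRHS](_ : _
     = 2 * th ^+ 2 * (2 * a + p + m) * v * (1 - y ^+ 2)); last by rewrite /v; ring.
  have q0 : 0 <= 2 * a + p + m by lra.
  by rewrite mulr_ge0 ?subr_ge0 // mulr_ge0 // mulr_ge0 // mulr_ge0 // sqr_ge0.
apply: (@le_trans _ _ (K * E * ((a + p) * expR (th * y * (2 * (a + m))) +
          (a + m) * expR (th * y * (- (2 * (a + p))))))).
  by rewrite le_eqVlt; apply/orP; left; apply/eqP; rewrite !(mulrA th); ring.
have KE : 0 <= K * E by rewrite mulr_ge0 // ltW.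
apply: (le_trans (ler_wpM2l KE S1)).
have -> : K * E * ((2 * a + p + m) * (1 + 2 * th ^+ 2 * v)) =
  K * (2 * a + p + m) * (E * (1 + 2 * th ^+ 2 * v)) by ring.
have -> : K * (a + p) + K * (a + m) = K * (2 * a + p + m) by ring.
by apply: ler_piMr EV; rewrite mulr_ge0 ?addr_ge0 ?mulr_ge0 // ltW.
Qed.
End score.

(** * Many independent columns: good codes and tails of scores *)

Section code.
Context {R : realType} {n d : nat}.

(** Indexed by columns first, so that sums over codes of products over columns factor. *)
Definition code := {ffun 'I_d -> {ffun 'I_n -> bool}}.

Definition code_mass (a : R) (X : code) : R := \prod_j polya a (X j).

Definition setrow (i : 'I_n) (b : {ffun 'I_d -> bool}) (X : code) : code :=
  [ffun j => upd i (b j) (X j)].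

Definition code_gap (X : code) : R := \sum_j (n%:R ^+ 2 - colsum (X j) ^+ 2).

(** The threshold is twice the bound on the mean in [code_gap_mean], so that Markov's inequality
    leaves half of the mass. *)
Definition good (a : R) (X : code) : bool :=
  code_gap X <= 4 * a * n%:R ^+ 2 * d%:R.

Definition code_score (a : R) (i : 'I_n) (X : code) (Y : 'I_d -> R) : R :=
  \sum_j Y j * score a i (X j).

Lemma code_mass_ge0 (a : R) (X : code) : 0 < a -> 0 <= code_mass a X.
Proof. by move=> a0; apply: prodr_ge0 => j _; rewrite ltW ?polya_gt0. Qed.

Lemma sum_code_mass_gt0 (a : R) : 0 < a -> 0 < \sum_(X : code) code_mass a X.
Proof.
move=> a0; pose X0 : code := [ffun=> [ffun=> true]].
rewrite (bigD1 X0) //= ltr_wpDr //.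
  by apply: sumr_ge0 => X _; exact: code_mass_ge0.
by apply: prodr_gt0 => j _; exact: polya_gt0.
Qed.

Lemma sum_setrow (i : 'I_n) (G : code -> R) :
  \sum_X \sum_(b : {ffun 'I_d -> bool}) G (setrow i b X)
  = 2 ^+ d * \sum_X G X.
Proof.
rewrite pair_big /=.
pose h (z : code * {ffun 'I_d -> bool}) :=
  (setrow i z.2 z.1, [ffun j => z.1 j i]).
have hE z : setrow i (h z).2 (h z).1 = z.1.
  apply/ffunP => j; apply/ffunP => k; rewrite !ffunE.
  by case: eqP => // ->.
have hh : involutive h.
  move=> [X b]; rewrite {1}/h hE; congr (_, _).
  by apply/ffunP => j; rewrite !ffunE eqxx.
rewrite (reindex_inj (inv_inj hh)) /=.
rewrite (eq_bigr (fun z => G z.1)) => [|z _]; last by rewrite hE.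
rewrite -(pair_big xpredT xpredT (fun X (_ : {ffun 'I_d -> bool}) => G X)) /=.
rewrite mulr_sumr; apply: eq_bigr => X _.
by rewrite sumr_const card_ffun card_bool card_ord -[_ *+ _]mulr_natl natrX.
Qed.

Lemma colsum_gap_ge0 (w : {ffun 'I_n -> bool}) :
  0 <= n%:R ^+ 2 - colsum w ^+ 2 :> R.
Proof.
rewrite subr_ge0 -[colsum w ^+ 2]real_normK ?num_real //.
rewrite lerXn2r ?nnegrE //; apply: (le_trans (ler_norm_sum _ _ _)).
rewrite (eq_bigr (fun=> 1)) ?sumr_const ?card_ord // => k _.
by case: (w k); rewrite /spin ?normrN normr1.
Qed.

Lemma code_gap_mean (a : R) : 0 < a ->
  \sum_X code_mass a X * code_gap X
  <= 2 * a * n%:R ^+ 2 * d%:R * \sum_X code_mass a X.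
Proof.
move=> a0; set Z := \sum_X code_mass a X.
(* Inserting the gap at column [j0] alone keeps each summand a product over columns. *)
pose F (j0 j : 'I_d) (w : {ffun 'I_n -> bool}) : R :=
  polya a w * (if j == j0 then n%:R ^+ 2 - colsum w ^+ 2 else 1).
have bound j0 : \sum_X code_mass a X * (n%:R ^+ 2 - colsum (X j0) ^+ 2)
    <= 2 * a * n%:R ^+ 2 * Z.
  rewrite (eq_bigr (fun X : code => \prod_j F j0 j (X j))); last first.
    move=> X _; rewrite /F big_split /= -/(code_mass a X); congr (_ * _).
    by rewrite (bigD1 j0) //= eqxx big1 ?mulr1 // => j /negPf ->.
  rewrite -(bigA_distr_bigA (F j0)) /Z /code_mass.
  rewrite -(bigA_distr_bigA (fun (_ : 'I_d) w => polya a w)) /=.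
  rewrite (bigD1 j0) //= [in leRHS](bigD1 j0) //= mulrA.
  have -> : \prod_(j | j != j0) \sum_w F j0 j w =
      \prod_(j < d | j != j0) \sum_(w : {ffun 'I_n -> bool}) polya a w.
    apply: eq_bigr => j /negPf jj; apply: eq_bigr => w _.
    by rewrite /F jj mulr1.
  apply: ler_wpM2r.
    by apply: prodr_ge0 => j _; apply: sumr_ge0 => w _; rewrite ltW ?polya_gt0.
  rewrite /F eqxx; exact: colsum_gap_mean.
rewrite (eq_bigr (fun X : code => \sum_j0 code_mass a X *
    (n%:R ^+ 2 - colsum (X j0) ^+ 2))) => [|X _]; last by rewrite mulr_sumr.
rewrite exchange_big /=.
apply: (le_trans (ler_sum _ (fun j0 _ => bound j0))).
by rewrite sumr_const card_ord -mulr_natl le_eqVlt; apply/orP; left; apply/eqP; ring.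
Qed.

Lemma good_mass (a : R) : 0 < a -> leq 1 n -> leq 1 d ->
  \sum_X code_mass a X <= 2 * \sum_(X | good a X) code_mass a X.
Proof.
move=> a0 n0 d0; have := code_gap_mean a a0.
set c := 2 * a * _ * _.
have c0 : 0 < c by rewrite /c !mulr_gt0 ?exprn_gt0 ?ltr0n.
rewrite (bigID (good a)) /= [X in _ <= _ * X -> _](bigID (good a)) /=.
rewrite [X in _ -> X <= _](bigID (good a)) /=.
set Zg := \sum_(X | good a X) code_mass a X.
set Zb := \sum_(X | ~~ good a X) code_mass a X.
move=> H.
have gap0 (X : code) : 0 <= code_gap X.
  by apply: sumr_ge0 => j _; exact: colsum_gap_ge0.
have H1 : 2 * c * Zb <= \sum_(X | ~~ good a X) code_mass a X * code_gap X.
  rewrite mulr_sumr; apply: ler_sum => X; rewrite /good -ltNge => gX.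
  rewrite mulrC ler_wpM2l ?code_mass_ge0 // ltW //.
  by apply: le_lt_trans gX; rewrite /c le_eqVlt; apply/orP; left; apply/eqP; ring.
have H2 : 0 <= \sum_(X | good a X) code_mass a X * code_gap X.
  by apply: sumr_ge0 => X _; rewrite mulr_ge0 ?code_mass_ge0.
have : c * (2 * Zb) <= c * (Zg + Zb) by lra.
rewrite ler_pM2l //; lra.
Qed.

(** In each column the variance exceeds [n%:R ^+ 2 - colsum (X j) ^+ 2] by at most
    [4 * a * n%:R ^+ 2]; the gaps are then summed using goodness. *)
Lemma good_var (a : R) (i : 'I_n) (X : code) : 0 < a -> a <= 1 -> good a X ->
  \sum_j score_var a i (X j) <= 8 * a * n%:R ^+ 2 * d%:R.
Proof.
move=> a0 a1 gX.
have n1 : 1 <= n%:R :> R by rewrite ler1n; case: n i => // [[]].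
apply: (@le_trans _ _ (\sum_j (4 * a * n%:R ^+ 2 +
    (n%:R ^+ 2 - colsum (X j) ^+ 2)))).
  apply: ler_sum => j _.
  have cs : spin (X j i) * colsum (X j) <= n%:R :> R.
    rewrite /colsum mulr_sumr.
    apply: (@le_trans _ _ (\sum_(k < n) 1)); last by rewrite sumr_const card_ord.
    apply: ler_sum => k _.
    by case: (X j i); case: (X j k); rewrite /spin; lra.
  have s2 := sqr_spin R (X j i).
  have aa : a * a <= a by rewrite -[leRHS]mulr1 ler_pM2l.
  have an : a * n%:R <= a * n%:R ^+ 2 by rewrite ler_pM2l // expr2 ler_peMl.
  have -> : score_var a i (X j) = n%:R ^+ 2 - colsum (X j) ^+ 2
      + (1 - spin (X j i) ^+ 2) + 4 * (a * n%:R) + 4 * (a * a) - 4 * a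
      + 2 * (spin (X j i) * colsum (X j)) - 2 * n%:R.
    by rewrite /score_var; ring.
  by rewrite s2; lra.
rewrite big_split /= sumr_const card_ord -mulr_natl -/(code_gap X).
apply: (le_trans (lerD (lexx _) gX)).
by rewrite le_eqVlt; apply/orP; left; apply/eqP; ring.
Qed.

(** A Chernoff bound for both signs. As [Y] is fixed while row [i] is resampled, the exponential
    moment factors over columns. *)
Lemma score_tail (a : R) (i : 'I_n) (X : code) (Y : 'I_d -> R) :
  0 < a -> a <= 1 -> (forall j, `|Y j| <= 1) ->
  \sum_(b : {ffun 'I_d -> bool}) code_mass a (setrow i b X) *
    (good a (setrow i b X) &&
      (a * d%:R <= `|code_score a i (setrow i b X) Y|))%:R
  <= 2 * expR (- (a * d%:R / (64 * n%:R ^+ 2))) *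
     \sum_(b : {ffun 'I_d -> bool}) code_mass a (setrow i b X).
Proof.
move=> a0 a1 Y1.
have n1 : 1 <= n%:R :> R by rewrite ler1n; case: n i => // [[]].
(* With variance at most [8 * a * n%:R ^+ 2 * d%:R], this choice makes the correction [2 * th ^+ 2]
   times the variance at most half of the gain [th * (a * d%:R)]. *)
pose th : R := (32 * n%:R ^+ 2)^-1.
have th0 : 0 < th by rewrite invr_gt0 mulr_gt0 // exprn_gt0 // (lt_le_trans ltr01).
have thn : th * (32 * n%:R ^+ 2) = 1.
  by rewrite mulVf // gt_eqF // mulr_gt0 // exprn_gt0 // (lt_le_trans ltr01).
have th1 (e : R) : `|e| = 1 -> `|e * th| * (4 * (n%:R + a)) <= 1.
  move=> e1; rewrite normrM e1 mul1r gtr0_norm // -[leRHS]thn.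
  rewrite ler_pM2l // expr2; nra.
pose W (e : R) (Z : code) :=
  expR (e * th * code_score a i Z Y - 2 * th ^+ 2 * \sum_j score_var a i (Z j)).
have mgf (e : R) : `|e| = 1 ->
    \sum_(b : {ffun 'I_d -> bool}) code_mass a (setrow i b X) * W e (setrow i b X)
    <= \sum_(b : {ffun 'I_d -> bool}) code_mass a (setrow i b X).
  move=> e1.
  rewrite (eq_bigr (fun b : {ffun 'I_d -> bool} => \prod_j
     (polya a (upd i (b j) (X j)) *
      expR (e * th * (Y j * score a i (upd i (b j) (X j))) -
        2 * (e * th) ^+ 2 * score_var a i (upd i (b j) (X j)))))); last first.
    move=> b _; rewrite big_split /=; congr (_ * _).
      by apply: eq_bigr => j _; rewrite ffunE.
    rewrite -expR_sum; congr expR; rewrite /code_score !mulr_sumr -sumrB.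
    have -> : (e * th) ^+ 2 = th ^+ 2.
      by rewrite exprMn -[e ^+ 2]real_normK ?num_real // e1 expr1n mul1r.
    by apply: eq_bigr => j _; rewrite [setrow i b X j]ffunE.
  rewrite -(bigA_distr_bigA (fun j b => polya a (upd i b (X j)) *
      expR (e * th * (Y j * score a i (upd i b (X j))) -
        2 * (e * th) ^+ 2 * score_var a i (upd i b (X j))))).
  rewrite [leRHS](eq_bigr (fun b : {ffun 'I_d -> bool} => \prod_j
     polya a (upd i (b j) (X j)))); last first.
    by move=> b _; apply: eq_bigr => j _; rewrite ffunE.
  rewrite -(bigA_distr_bigA (fun j b => polya a (upd i b (X j)))).
  apply: ler_prod => j _; apply/andP; split; last by apply: score_mgf; rewrite ?th1.
  by apply: sumr_ge0 => b _; rewrite mulr_ge0 ?expR_ge0 // ltW ?polya_gt0.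
set K := expR _.
have pt (Z : code) :
    (good a Z && (a * d%:R <= `|code_score a i Z Y|))%:R <= K * (W 1 Z + W (-1) Z).
  have W0 e : 0 <= W e Z by exact: expR_ge0.
  have K0 : 0 <= K by exact: expR_ge0.
  case: andP => [[gZ]|_]; last by rewrite mulr_ge0 ?addr_ge0.
  have V := good_var a i Z a0 a1 gZ.
  have key (e : R) : a * d%:R <= e * code_score a i Z Y -> 1 <= K * W e Z.
    move=> he; rewrite /K /W -exp.expRD -[leLHS]exp.expR0 ler_expR.
    have -> : a * d%:R / (64 * n%:R ^+ 2) = th * (a * d%:R) / 2.
      by rewrite /th; field; rewrite gt_eqF // (lt_le_trans ltr01).
    have h1 : th * (a * d%:R) <= th * (e * code_score a i Z Y) by rewrite ler_pM2l.
    have h2 : 2 * th ^+ 2 * \sum_j score_var a i (Z j) <=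
        2 * th ^+ 2 * (8 * a * n%:R ^+ 2 * d%:R).
      by rewrite ler_wpM2l // mulr_ge0 // sqr_ge0.
    have e3 : 2 * th ^+ 2 * (8 * a * n%:R ^+ 2 * d%:R) =
       th * (a * d%:R) / 2 * (th * (32 * n%:R ^+ 2)) by field.
    rewrite e3 thn mulr1 in h2.
    have -> : e * th * code_score a i Z Y = th * (e * code_score a i Z Y) by ring.
    lra.
  rewrite ler_normr => /orP[h|h].
    by rewrite mulrDr; apply: (le_trans (key 1 _)); rewrite ?mul1r // lerDl mulr_ge0.
  by rewrite mulrDr; apply: (le_trans (key (-1) _)); rewrite ?mulN1r // lerDr mulr_ge0.
apply: (@le_trans _ _ (\sum_(b : {ffun 'I_d -> bool}) code_mass a (setrow i b X) *
   (K * (W 1 (setrow i b X) + W (-1) (setrow i b X))))).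
  by apply: ler_sum => b _; rewrite ler_wpM2l ?code_mass_ge0.
rewrite (eq_bigr (fun b => K * (code_mass a (setrow i b X) * W 1 (setrow i b X))
  + K * (code_mass a (setrow i b X) * W (-1) (setrow i b X)))); last first.
  by move=> b _; ring.
rewrite big_split /= -!mulr_sumr -mulrDr (mulrC 2) -mulrA.
rewrite ler_wpM2l ?expR_ge0 //.
have := mgf 1 (normr1 _); have := mgf (-1) (etrans (normrN _) (normr1 _)); lra.
Qed.
End code.

(** * Singular values through the Gram matrix of the rows *)

Lemma sorted_top_two (F : realFieldType) (s : seq F) :
  sorted (fun x y => y <= x) s -> (forall x, x \in s -> 0 <= x) ->
  [/\ \sum_(x <- s) x ^+ 2 <= s`_0 * \sum_(x <- s) x,
      0 <= s`_0 & s`_1 <= \sum_(x <- s) x - s`_0].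
Proof.
case: s => [|x s] /=; first by rewrite !big_nil mulr0 subr0.
move=> srt s0.
have xs z : z \in s -> z <= x.
  by apply/allP: z; apply: order_path_min srt => u v t /= h1 h2; exact: le_trans h1.
have x0 : 0 <= x by apply: s0; rewrite mem_head.
have s0' z : z \in s -> 0 <= z by move=> zs; apply: s0; rewrite inE zs orbT.
split=> //.
  rewrite !big_cons mulrDr -expr2 lerD2l mulr_sumr !big_seq.
  by apply: ler_sum => z zs; rewrite expr2 ler_wpM2r ?xs ?s0'.
rewrite big_cons addrAC subrr add0r.
case: s s0' {srt s0 xs} => [|z s] s0' /=; first by rewrite big_nil.
rewrite big_cons lerDl big_seq; apply: sumr_ge0 => u us.
by apply: s0'; rewrite inE us orbT.
Qed.

Definition gram {n d : nat} (X : 'M[R]_(n, d)) (i k : 'I_n) : R :=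
  \sum_j X i j * X k j.

Lemma gram_diag (n d : nat) (X : 'M[R]_(n, d)) i : dataset X -> gram X i i = 1.
Proof.
move=> dX; rewrite -(dX i) /sqnorm; apply: eq_bigr => j _.
by rewrite mxE expr2.
Qed.

Lemma trace_XtX (n d : nat) (X : 'M[R]_(n, d)) : dataset X ->
  \tr (X^T *m X) = n%:R.
Proof.
move=> dX; rewrite mxtrace_mulC /mxtrace (eq_bigr (fun=> 1)).
  by rewrite sumr_const card_ord.
move=> i _; rewrite -(gram_diag _ _ X i dX) mxE.
by apply: eq_bigr => j _; rewrite mxE.
Qed.

(** Cyclicity of the trace passes from [X^T *m X] to the Gram matrix [X *m X^T]. *)
Lemma trace_XtX_sqr (n d : nat) (X : 'M[R]_(n, d)) :
  \tr ((X^T *m X) *m (X^T *m X)) = \sum_i \sum_k gram X i k ^+ 2.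
Proof.
rewrite -mulmxA mxtrace_mulC -mulmxA -mulmxA (mulmxA X) /mxtrace.
apply: eq_bigr => i _; rewrite mxE; apply: eq_bigr => k _.
rewrite expr2 !mxE; congr (_ * _); apply: eq_bigr => j _; rewrite !mxE //.
by rewrite mulrC.
Qed.

(** Sum the tangent inequality [2 * c * t - c ^+ 2 <= t ^+ 2] over all entries. *)
Lemma gram_sqr_ge (n d : nat) (X : 'M[R]_(n, d)) (c : R) : 0 <= c ->
  c * n%:R ^+ 2 <= \sum_i \sum_k gram X i k ->
  c ^+ 2 * n%:R ^+ 2 <= \sum_i \sum_k gram X i k ^+ 2.
Proof.
move=> c0 H.
have : \sum_i \sum_k (2 * c * gram X i k - c ^+ 2)
    <= \sum_i \sum_k gram X i k ^+ 2.
  apply: ler_sum => i _; apply: ler_sum => k _.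
  have := sqr_ge0 (gram X i k - c); rewrite !expr2; lra.
apply: le_trans.
rewrite (eq_bigr (fun i => 2 * c * (\sum_k gram X i k) - c ^+ 2 *+ n)).
  rewrite sumrB -mulr_sumr sumr_const card_ord -mulrnA -[c ^+ 2 *+ _]mulr_natr natrM.
  have := ler_wpM2l c0 H; rewrite !expr2; lra.
by move=> i _; rewrite sumrB -mulr_sumr sumr_const card_ord.
Qed.

Lemma eigenvalue_XtX_ge0 (n d : nat) (X : 'M[R]_(n, d)) (x : R) :
  eigenvalue (X^T *m X) x -> 0 <= x.
Proof.
move=> /eigenvalueP[u ux u0].
have pos (m : nat) (z : 'rV[R]_m) : (z *m z^T) ord0 ord0 = \sum_j z ord0 j ^+ 2.
  by rewrite mxE; apply: eq_bigr => j _; rewrite mxE expr2.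
have u_gt0 : 0 < \sum_j u ord0 j ^+ 2.
  rewrite lt_neqAle sumr_ge0 ?andbT => [|j _]; last exact: sqr_ge0.
  apply: contra u0 => /eqP/esym/eqP.
  rewrite psumr_eq0 => [/allP uj|j _]; last exact: sqr_ge0.
  apply/eqP/rowP => j; rewrite mxE; apply/eqP.
  by rewrite -sqrf_eq0; apply: uj; rewrite mem_index_enum.
have : x * \sum_j u ord0 j ^+ 2 = \sum_j (u *m X^T) ord0 j ^+ 2.
  by rewrite -!pos trmx_mul trmxK mulmxA -(mulmxA u) ux -scalemxAl [RHS]mxE.
move=> xu; rewrite -(pmulr_lge0 _ u_gt0) xu.
by apply: sumr_ge0 => j _; exact: sqr_ge0.
Qed.

(** The squared singular values sum to [n], and the largest is at least the sum of their squares
    divided by [n], hence at least [(1 - 2 * e) * n]. At most [2 * e * n] remains for the second. *)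
Lemma singular_gap (n d : nat) (X : 'M[R]_(n, d)) (e g : R) :
  leq 1 n -> dataset X -> 0 <= e <= 1 -> 0 <= g -> 2 * e <= g ^+ 2 * (1 - 2 * e) ->
  (1 - e) * n%:R ^+ 2 <= \sum_i \sum_k gram X i k ->
  singular_value X 2 <= g * singular_value X 1.
Proof.
move=> n0 dX /andP[e0 e1] g0 eg H; rewrite /singular_value /=.
(* In the default case of [xget] the list is empty and both singular values are 0. *)
case: xgetP => [s _ [szs srt chX]|_]; last by rewrite !nth_nil sqrtr0 mulr0.
have s_ge0 x : x \in s -> 0 <= x.
  move=> xs; apply: (eigenvalue_XtX_ge0 _ _ X).
  by rewrite eigenvalue_root_char chX root_prod_XsubC.
have [] := sorted_top_two _ _ srt s_ge0.
rewrite -(trace_sum_roots _ _ _ _ szs chX) -(trace_sqr_sum_roots _ _ _ _ szs chX).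
rewrite trace_XtX // trace_XtX_sqr => h1 s00 h2.
have c0 : 0 <= 1 - e by lra.
have h3 := gram_sqr_ge _ _ X _ c0 H.
have n1 : 0 < n%:R :> R by rewrite ltr0n.
have h4 : (1 - e) ^+ 2 * n%:R <= s`_0.
  by rewrite -(ler_pM2r n1) -mulrA -expr2 (le_trans h3).
rewrite -[g]ger0_norm // -sqrtr_sqr -sqrtrM ?sqr_ge0 // ler_wsqrtr //.
have h5 : (1 - 2 * e) * n%:R <= s`_0.
  apply: le_trans h4; rewrite ler_pM2r //.
  by have := sqr_ge0 e; rewrite !expr2; lra.
have := ler_wpM2l (sqr_ge0 g) h5.
have : 2 * e * n%:R <= g ^+ 2 * (1 - 2 * e) * n%:R by rewrite ler_pM2r.
lra.
Qed.

(** * Continuity, compactness of the sphere, measurability *)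

Lemma continuous_sumr (F : realType) (T : topologicalType) (I : finType)
    (f : I -> T -> F) :
  (forall i, continuous (f i)) -> continuous (fun x => \sum_i f i x).
Proof.
by move=> cf; apply: continuous_big => [|i _]; [exact: add_continuous | exact: cf].
Qed.

Lemma continuous_sqnormXy (n d : nat) (X : 'M[R]_(n, d)) :
  continuous (fun y : 'rV[R]_d => sqnormXy X y).
Proof.
rewrite /sqnormXy; apply: continuous_sumr => i.
have cs : continuous (fun y : 'rV[R]_d => \sum_j X i j * y ord0 j).
  apply: continuous_sumr => j y.
  apply: (@continuousM _ _ (fun=> X i j) (fun y : 'rV[R]_d => y ord0 j)).
    exact: cst_continuous.
  exact: coord_continuous.
by move=> y; apply: (@continuousM _ _ _ _ y); exact: cs.
Qed.

Lemma closed_sphere (d : nat) : closed (sphere d).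
Proof.
apply: (@preimage_closed _ _ (fun y : 'rV[R]_d => sqnorm y) [set x | x = 1]%classic);
  last exact: closed_eq.
move=> y _; move: y; rewrite /sqnorm; apply: continuous_sumr => j y.
by apply: (@continuousM _ _ (fun y : 'rV[R]_d => y ord0 j)); exact: coord_continuous.
Qed.

Lemma compact_sphere (d : nat) : compact (sphere d).
Proof.
apply: bounded_closed_compact; last exact: closed_sphere.
exists 1; split; first exact: num_real.
move=> M M1 y y1; rewrite /Num.Def.normr /= mx_normrE.
apply/bigmax_leP; split; first by rewrite ltW // (lt_trans ltr01).
move=> [i j] _ /=; rewrite (ord1 i); apply: le_trans (ltW M1).
have : `|y ord0 j| ^+ 2 <= 1.
  rewrite real_normK ?num_real // -y1 /sqnorm (bigD1 j) //= lerDl.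
  by apply: sumr_ge0 => k _; exact: sqr_ge0.
by rewrite expr_le1.
Qed.

(** The accuracy guarantee refers to a given maximiser; the extreme value theorem on the sphere
    supplies one. *)
Lemma top_right_sv_exists (n d : nat) (X : 'M[R]_(n, d)) :
  leq 1 d -> exists v, top_right_sv X v.
Proof.
case: d X => // d X _.
have ne : (sphere d.+1 !=set0)%classic.
  exists (delta_mx ord0 ord0); rewrite /sphere /= /sqnorm (bigD1 ord0) //=.
  rewrite mxE !eqxx expr1n big1 ?addr0 // => j /negPf j0.
  by rewrite mxE eqxx j0 expr0n.
have [v vS vmax] := EVT_max_rV ne (@compact_sphere d.+1)
  (continuous_subspaceT (@continuous_sqnormXy n d.+1 X)).
exists v; split; first exact: set_mem.
by move=> u uS; apply: vmax; exact: mem_set.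
Qed.

Lemma closed_measurable_vecB (d : nat) (T : set 'rV[R]_d) :
  closed T -> measurable (T : set (vecB d)).
Proof.
move=> cT; rewrite -[T]setCK; apply: measurableC.
by apply: sub_sigma_algebra; exact: closed_openC.
Qed.

(** * Accurate outputs correlate with the sum of the rows *)

Lemma cauchy_schwarz_unit (d : nat) (u y : 'I_d -> R) :
  \sum_j y j ^+ 2 = 1 -> (\sum_j u j * y j) ^+ 2 <= \sum_j u j ^+ 2.
Proof.
move=> y1; set p := \sum_j _ * _.
have : 0 <= \sum_j (u j - p * y j) ^+ 2 by apply: sumr_ge0 => j _; exact: sqr_ge0.
rewrite (eq_bigr (fun j => u j ^+ 2 - 2 * p * (u j * y j) + p ^+ 2 * y j ^+ 2));
  last by move=> j _; ring.
by rewrite big_split sumrB /= -!mulr_sumr y1 -/p !expr2; lra.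
Qed.

(** With [t i] the inner product of row [i] and [y], the left-hand side is half the sum of all
    [(t i - t k) ^+ 2], and each of these is at most the squared distance [2 - 2 * gram X i k]. *)
Lemma gram_spread (n d : nat) (X : 'M[R]_(n, d)) (y : 'rV[R]_d) :
  dataset X -> sphere d y ->
  n%:R * sqnormXy X y - (\sum_i \sum_j X i j * y ord0 j) ^+ 2
  <= n%:R ^+ 2 - \sum_i \sum_k gram X i k.
Proof.
move=> dX y1; pose t i := \sum_j X i j * y ord0 j.
have const (c : R) : \sum_(k < n) c = n%:R * c.
  by rewrite sumr_const card_ord mulr_natl.
have pair i k : (t i - t k) ^+ 2 <= 2 - 2 * gram X i k.
  have -> : t i - t k = \sum_j (X i j - X k j) * y ord0 j.
    by rewrite /t -sumrB; apply: eq_bigr => j _; rewrite mulrBl.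
  apply: (le_trans (cauchy_schwarz_unit _ (fun j => X i j - X k j) _ y1)).
  rewrite (eq_bigr (fun j => X i j * X i j + X k j * X k j - 2 * (X i j * X k j)));
    last by move=> j _; ring.
  by rewrite sumrB -mulr_sumr big_split /= -!/(gram X _ _) !gram_diag //; lra.
have : \sum_i \sum_k (t i - t k) ^+ 2 <= \sum_i \sum_k (2 - 2 * gram X i k).
  by apply: ler_sum => i _; apply: ler_sum => k _.
rewrite (eq_bigr (fun i => n%:R * t i ^+ 2 - 2 * t i * (\sum_k t k)
    + \sum_k t k ^+ 2)); last first.
  move=> i _; rewrite mulr_sumr -const.
  by rewrite -sumrB -big_split /=; apply: eq_bigr => k _; ring.
rewrite big_split sumrB /= -mulr_sumr -mulr_suml -mulr_sumr const.
rewrite [X in _ <= X -> _](eq_bigr (fun i => n%:R * 2 - 2 * \sum_k gram X i k));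
  last by move=> i _; rewrite sumrB -mulr_sumr const.
rewrite sumrB const -[X in _ <= _ - X -> _]mulr_sumr.
have -> : sqnormXy X y = \sum_i t i ^+ 2 by [].
have -> : \sum_i \sum_j X i j * y ord0 j = \sum_i t i by [].
rewrite [in n%:R ^+ 2]expr2 [(\sum_i t i) ^+ 2]expr2.
set A := \sum_i t i; set B := \sum_i _ ^+ 2; set C := \sum_i \sum_k _.
lra.
Qed.

Lemma estimate_correlation (n d : nat) (X : 'M[R]_(n, d)) (v y : 'rV[R]_d) (e : R) :
  leq 1 n -> dataset X -> 0 <= e <= 1 / 16 ->
  (1 - e) * n%:R ^+ 2 <= \sum_i \sum_k gram X i k ->
  top_right_sv X v -> sphere d y ->
  sqnormXy X v - 1 / 4 * n%:R <= sqnormXy X y ->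
  3 / 4 * n%:R <= `|\sum_i \sum_j X i j * y ord0 j|.
Proof.
move=> n0 dX /andP[e0 e1] H [_ vmax] y1 acc.
have n1 : 0 < n%:R :> R by rewrite ltr0n.
(* The rows themselves serve as trial vectors, and the maximum dominates their average. *)
have hv : (1 - e) ^+ 2 * n%:R <= sqnormXy X v.
  rewrite -(ler_pM2r n1) -mulrA -expr2.
  have c0 : 0 <= 1 - e by lra.
  apply: (le_trans (gram_sqr_ge _ _ X _ c0 H)).
  have -> : sqnormXy X v * n%:R = \sum_(k < n) sqnormXy X v.
    by rewrite sumr_const card_ord mulr_natr.
  rewrite exchange_big /=.
  apply: ler_sum => k _; apply: le_trans (vmax (row k X) (dX k)).
  rewrite le_eqVlt; apply/orP; left; apply/eqP; apply: eq_bigr => i _.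
  by congr (_ ^+ 2); apply: eq_bigr => j _; rewrite mxE.
have sp := gram_spread _ _ X y dX y1.
set T := \sum_i _ in sp *.
(* The losses are [2 * e] from the top value, [1 / 4] from accuracy and [e] from the spread;
   [e <= 1 / 16] leaves [9 / 16]. *)
have : (3 / 4 * n%:R) ^+ 2 <= `|T| ^+ 2.
  rewrite real_normK ?num_real //.
  have h1 : (1 - 2 * e) * n%:R <= sqnormXy X v.
    apply: le_trans hv; rewrite ler_pM2r //.
    by have := sqr_ge0 e; rewrite !expr2; lra.
  have h2 : n%:R * ((3 / 4 - 2 * e) * n%:R) <= n%:R * sqnormXy X y.
    by rewrite ler_pM2l //; lra.
  have h3 : e * n%:R ^+ 2 <= 1 / 16 * n%:R ^+ 2 by rewrite ler_wpM2r // sqr_ge0.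
  rewrite !expr2 in h3 sp H *; lra.
by rewrite ler_pXn2r // nnegrE //; lra.
Qed.

(** * Averaging and union bounds for probability measures *)

(** Exchanging sum and integral carries a bound for each fixed output over to a random output. *)
Lemma weighted_prob_le {disp : measure_display} {T : measurableType disp}
    {F : realType} (P : probability T F) (I : finType) (w : I -> F)
    (A : I -> set T) (c : F) :
  (forall i, measurable (A i)) -> (forall i, 0 <= w i) ->
  (forall y, \sum_i w i * \1_(A i) y <= c) ->
  \sum_i w i * fine (P (A i)) <= c.
Proof.
move=> mA w0 H; rewrite -lee_fin -sumEFin.
have mf i : measurable_fun setT (fun y => (w i * \1_(A i) y)%:E).
  apply/measurable_EFinP; apply: measurable_funM; first exact: measurable_cst.
  exact: measurable_indic.
have f0 i y : (0 <= ((w i * \1_(A i) y)%:E))%E by rewrite lee_fin mulr_ge0.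
have -> : (\sum_i (w i * fine (P (A i)))%:E)%E =
    (\int[P]_y \sum_(i <- index_enum I) ((w i * \1_(A i) y)%:E))%E.
  rewrite ge0_integral_sum //; apply: eq_bigr => i _.
  under eq_integral do rewrite EFinM.
  rewrite ge0_integralZl_EFin //; last first.
    by apply/measurable_EFinP; exact: measurable_indic.
  by rewrite integral_indic // setIT EFinM fineK // fin_num_measure.
apply: (@le_trans _ _ (\int[P]_y (cst c%:E y))%E).
  apply: ge0_le_integral => //.
  - by move=> y _; apply: sume_ge0.
  - by apply: emeasurable_sum.
  - by move=> y _; rewrite sumEFin lee_fin.
by rewrite integral_cst // [X in (_ * X)%E](@probability_setT _ _ _ P) mule1.
Qed.

Lemma prob_le_sum {disp : measure_display} {T : measurableType disp}
    {F : realType} (P : probability T F) (I : finType) (A S : set T)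
    (E : I -> set T) :
  measurable A -> measurable S -> (forall i, measurable (E i)) ->
  P S = 1%E -> (forall y, A y -> S y -> exists i, E i y) ->
  fine (P A) <= \sum_i fine (P (E i)).
Proof.
move=> mA mS mE PS cov.
(* The covering hypothesis says that no point lies in [A], [S] and all complements of the [E i] at
   once, so at most [#|I| + 1] of these [#|I| + 2] events hold together. *)
pose B (o : I + bool) : set T :=
  match o with inl i => (~` E i)%classic | inr true => A | inr false => S end.
have mB o : measurable (B o).
  by case: o => [i|[]] //=; exact: measurableC.
have indicC (y : T) i : \1_(~` E i)%classic y = 1 - \1_(E i) y :> F.
  by rewrite !indicE in_setC; case: (y \in E i); rewrite /= ?subr0 ?subrr.
have const : \sum_(i : I) (1 : F) = #|I|%:R by rewrite sumr_const.
have := @weighted_prob_le _ _ _ P _ (fun=> 1) B (#|I|%:R + 1) mB (fun=> ler01).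
rewrite big_sumType big_bool /= PS /= !mul1r.
have -> : \sum_i 1 * fine (P (~` E i)%classic) = #|I|%:R - \sum_i fine (P (E i)).
  rewrite -const -sumrB; apply: eq_bigr => i _.
  by rewrite mul1r probability_setC // fineB ?fin_num_measure.
suff H : forall y, \sum_o 1 * \1_(B o) y <= #|I|%:R + 1 :> F.
  by move=> /(_ H); lra.
move=> y; rewrite big_sumType big_bool /= !mul1r.
rewrite (eq_bigr (fun i => 1 - \1_(E i) y)) => [|i _]; last by rewrite mul1r indicC.
rewrite sumrB const.
have sE0 : 0 <= \sum_i \1_(E i) y :> F by apply: sumr_ge0.
have [yA|yA] := boolP (y \in A); have [yS|yS] := boolP (y \in S);
  rewrite !indicE ?(negPf yA) ?(negPf yS) ?yA ?yS /=; try lra.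
have [i Ei] := cov y (set_mem yA) (set_mem yS).
suff : 1 <= \sum_i \1_(E i) y :> F by lra.
rewrite (bigD1 i) //= indicE mem_set //= lerDl; exact: sumr_ge0.
Qed.

(** * Clipping of coordinates *)

Definition clip {F : realType} (z : F) : F := Num.max (-1) (Num.min z 1).

Lemma norm_clip_le1 (F : realType) (z : F) : `|clip z| <= 1.
Proof.
by rewrite /clip ler_norml !le_max !ge_max !ge_min !lexx ?orbT /= andbT; lra.
Qed.

(** Beyond 1 this is [(z - 2) ^+ 2 >= 0], below -1 its mirror image. A quadratic bound is what the
    unit norm of the output can pay for. *)
Lemma clip_dist (F : realType) (z : F) : `|z - clip z| <= z ^+ 2 / 4.
Proof.
have h1 := sqr_ge0 (z - 2); have h2 := sqr_ge0 (z + 2); have h3 := sqr_ge0 z.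
rewrite ler_norml /clip !expr2 in h1 h2 h3 *.
have [z1|z1] := leP z 1; last first.
  rewrite (max_r (_ : -1 <= 1)); last by lra.
  by apply/andP; split; lra.
by have [z2|z2] := leP (-1) z; apply/andP; split; lra.
Qed.

Lemma continuous_clip (F : realType) : continuous (@clip F).
Proof.
apply: (@max_fun_continuous _ F F (fun=> -1) (fun z => Num.min z 1)).
  exact: cst_continuous.
apply: (@min_fun_continuous _ F F id (fun=> 1)); last exact: cst_continuous.
by move=> z; exact: cvg_id.
Qed.

Lemma continuous_abs (F : realType) : continuous (fun x : F => `|x|).
Proof. by move=> x; exact: norm_continuous. Qed.

(** * Codes as datasets; accurate outputs point to a row *)

Section code_matrix.
Context {n d : nat}.
Local Notation code := (@code n d).

Definition code_mx (X : code) : 'M[R]_(n, d) :=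
  \matrix_(i, j) (spin (X j i) / Num.sqrt d%:R).

(* The accuracy hypothesis does not prevent [y] from putting a constant part of
   its mass on the few non-constant columns; clipping does. *)
Definition clipv (y : 'rV[R]_d) (j : 'I_d) : R := clip (Num.sqrt d%:R * y ord0 j).

(** The threshold is the average share of a row when the scores total [a * n%:R * d%:R]. *)
Definition traced (a : R) (i : 'I_n) (X : code) : set 'rV[R]_d :=
  [set y | a * d%:R <= `|code_score a i X (clipv y)|]%classic.

Lemma dataset_code_mx (X : code) : leq 1 d -> dataset (code_mx X).
Proof.
move=> d0 i; rewrite /sphere /= /sqnorm.
have d1 : 0 < d%:R :> R by rewrite ltr0n.
rewrite (eq_bigr (fun=> d%:R^-1)).
  by rewrite sumr_const card_ord -[_ *+ d]mulr_natr mulVf // gt_eqF.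
move=> j _; rewrite !mxE exprMn sqr_spin exprVn sqr_sqrtr ?mul1r //; exact: ltW.
Qed.

Lemma sum_gram_code_mx (X : code) :
  \sum_i \sum_k gram (code_mx X) i k = (\sum_j colsum (X j) ^+ 2) / d%:R.
Proof.
have -> : \sum_i \sum_k gram (code_mx X) i k =
    \sum_i \sum_j \sum_k code_mx X i j * code_mx X k j.
  by apply: eq_bigr => i _; rewrite exchange_big.
rewrite exchange_big /= mulr_suml; apply: eq_bigr => j _.
rewrite /colsum expr2 mulr_suml mulr_suml; apply: eq_bigr => i _.
rewrite mulr_sumr mulr_suml; apply: eq_bigr => k _.
rewrite !mxE -[in RHS](@sqr_sqrtr _ d%:R) ?ler0n // -exprVn; ring.
Qed.

Lemma good_gram (a : R) (X : code) : leq 1 d -> good a X ->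
  (1 - 4 * a) * n%:R ^+ 2 <= \sum_i \sum_k gram (code_mx X) i k.
Proof.
move=> d0; have d1 : 0 < d%:R :> R by rewrite ltr0n.
rewrite sum_gram_code_mx /good /code_gap sumrB sumr_const card_ord -[_ *+ d]mulr_natr.
by move=> H; rewrite ler_pdivlMr //; lra.
Qed.

(** Before clipping the correlation with the column sums is at least [3 / 4 * n%:R * d%:R]; clipping
    costs at most a third of that. As the scores add up to [2 * a * Q], some row reaches the
    average. *)
Lemma accurate_traced (a : R) (X : code) (v y : 'rV[R]_d) :
  leq 1 n -> leq 1 d -> 0 < a -> a <= 1 / 64 -> good a X ->
  top_right_sv (code_mx X) v -> sphere d y ->
  sqnormXy (code_mx X) v - 1 / 4 * n%:R <= sqnormXy (code_mx X) y ->
  exists i, traced a i X y.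
Proof.
move=> n0 d0 a0 a1 gX tv y1 acc.
have d1 : 0 < d%:R :> R by rewrite ltr0n.
have n1 : 0 < n%:R :> R by rewrite ltr0n.
have e01 : 0 <= 4 * a <= 1 / 16 by apply/andP; split; lra.
have := estimate_correlation _ _ _ _ _ _ n0 (dataset_code_mx X d0) e01
  (good_gram a X d0 gX) tv y1 acc.
pose rt : R := Num.sqrt d%:R.
have rt0 : 0 < rt by rewrite sqrtr_gt0.
have rt2 : rt ^+ 2 = d%:R by rewrite sqr_sqrtr // ltW.
pose z j := rt * y ord0 j.
have -> : \sum_i \sum_j code_mx X i j * y ord0 j = (\sum_j z j * colsum (X j)) / d%:R.
  rewrite exchange_big /= mulr_suml; apply: eq_bigr => j _.
  rewrite /colsum mulr_sumr mulr_suml; apply: eq_bigr => i _.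
  by rewrite mxE -/rt /z -rt2; field; rewrite gt_eqF.
rewrite normrM normfV (gtr0_norm d1) ler_pdivlMr // => corr.
have z2 : \sum_j z j ^+ 2 = d%:R.
  have y1' : \sum_j y ord0 j ^+ 2 = 1 := y1.
  rewrite (eq_bigr (fun j => d%:R * y ord0 j ^+ 2)); last first.
    by move=> j _; rewrite /z exprMn rt2.
  by rewrite -mulr_sumr y1' mulr1.
pose Q := \sum_j clipv y j * colsum (X j).
have diff : `|\sum_j z j * colsum (X j) - Q| <= d%:R * n%:R / 4.
  rewrite /Q -sumrB; apply: (le_trans (ler_norm_sum _ _ _)).
  rewrite -z2 -mulrA mulr_suml; apply: ler_sum => j _.
  have Sn : `|colsum (X j)| <= n%:R :> R.
    have := @colsum_gap_ge0 R _ (X j); rewrite subr_ge0 => h.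
    by rewrite -(@ler_pXn2r _ 2) ?nnegrE // real_normK ?num_real.
  have -> : z j ^+ 2 * (n%:R / 4) = z j ^+ 2 / 4 * n%:R by ring.
  by rewrite -mulrBl normrM ler_pM // clip_dist.
have Qbig : d%:R * n%:R / 2 <= `|Q|.
  have tri := ler_normB (\sum_j z j * colsum (X j)) (\sum_j z j * colsum (X j) - Q).
  rewrite subKr in tri.
  have tri2 := ler_normD Q (\sum_j z j * colsum (X j) - Q).
  rewrite addrC subrK in tri2.
  lra.
apply: contrapT => /forallNP no.
have small i : `|code_score a i X (clipv y)| < a * d%:R.
  by rewrite ltNge; apply/negP => h; exact: (no i).
have tot : \sum_i code_score a i X (clipv y) = 2 * a * Q.
  rewrite /code_score exchange_big /= /Q mulr_sumr; apply: eq_bigr => j _.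
  by rewrite -mulr_sumr sum_score; ring.
have : `|2 * a * Q| < n%:R * (a * d%:R).
  rewrite -tot; apply: (le_lt_trans (ler_norm_sum _ _ _)).
  have -> : n%:R * (a * d%:R) = \sum_(i < n) (a * d%:R).
    by rewrite sumr_const card_ord mulr_natl.
  apply: ltr_sum => // ; first by apply/hasP; exists (Ordinal n0); rewrite ?mem_index_enum.
rewrite normrM (gtr0_norm (_ : 0 < 2 * a)) ?mulr_gt0 // => h.
have := ler_wpM2l (ltW a0) Qbig; lra.
Qed.

Lemma measurable_traced (a : R) (i : 'I_n) (X : code) :
  measurable (traced a i X : set (vecB d)).
Proof.
apply: closed_measurable_vecB.
apply: (@preimage_closed _ _ (fun y => `|code_score a i X (clipv y)|)
  [set x | a * d%:R <= x]%classic); last exact: closed_ge.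
move=> y _; apply: (@continuous_comp _ _ _ (fun y => code_score a i X (clipv y))
  (fun x : R => `|x|)); last exact: continuous_abs.
move: y; rewrite /code_score; apply: continuous_sumr => j y.
apply: (@continuousM _ _ (fun y => clipv y j) (fun=> score a i (X j)));
  last exact: cst_continuous.
apply: (@continuous_comp _ _ _ (fun y : 'rV[R]_d => Num.sqrt d%:R * y ord0 j));
  last exact: continuous_clip.
apply: (@continuousM _ _ (fun=> Num.sqrt d%:R) (fun y : 'rV[R]_d => y ord0 j)).
  exact: cst_continuous.
exact: coord_continuous.
Qed.

Lemma setrow_setrow (i : 'I_n) (b c : {ffun 'I_d -> bool}) (X : code) :
  setrow i b (setrow i c X) = setrow i b X.
Proof.
by apply/ffunP => j; apply/ffunP => k; rewrite !ffunE; case: eqP.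
Qed.

End code_matrix.

(** * Privacy against tracing *)

Section tracing.
Context {n d : nat}.
Local Notation code := (@code n d).

Definition blank (i : 'I_n) (X : code) : code := setrow i [ffun=> true] X.

(** The mechanism reads the blanked code while the test uses the true row [i], so given the other
    rows the output is independent of row [i]. *)
Definition fresh_prob (Mg : 'M[R]_(n, d) -> probability (vecB d) R)
    (a : R) (i : 'I_n) (X : code) : R :=
  fine (Mg (code_mx (blank i X)) (traced a i X : set (vecB d))).

Lemma private_traced (Mg : 'M[R]_(n, d) -> probability (vecB d) R)
    (delta a : R) (i : 'I_n) (X : code) :
  leq 1 d -> 0 <= delta -> diff_private 1 delta Mg ->
  fine (Mg (code_mx X) (traced a i X : set (vecB d)))
  <= expR 1 * fresh_prob Mg a i X + delta.
Proof.
move=> d0 delta0 dp; set T := traced a i X : set (vecB d).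
have mT : measurable T := measurable_traced a i X.
have fin Y : (fine (Mg Y T))%:E = Mg Y T by rewrite fineK // fin_num_measure.
rewrite -lee_fin EFinD EFinM /fresh_prob -/T !fin.
(* Neighbours have to differ, so a row [i] that is already constant is treated apart; the datasets
   then coincide. *)
have [E|neq] := eqVneq (row i (code_mx X)) (row i (code_mx (blank i X))).
  have -> : code_mx (blank i X) = code_mx X.
    apply/row_matrixP => k; have [-> //|ki] := eqVneq k i.
    by apply/rowP => j; rewrite !mxE !ffunE (negPf ki).
  rewrite -fin -EFinM -EFinD lee_fin.
  apply: ler_wpDr => //; apply: ler_peMl; first exact: fine_ge0.
  by apply: le_trans (expR_ge1Dx _); rewrite lerDl.
apply: dp => //; try exact: dataset_code_mx.
exists i; split=> // k /eqP ki.
by apply/rowP => j; rewrite !mxE !ffunE (negPf ki).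
Qed.

(** Resampling row [i] leaves the blanked input unchanged, so [score_tail] can be integrated against
    a single output law. *)
Lemma fresh_prob_mean (Mg : 'M[R]_(n, d) -> probability (vecB d) R)
    (a : R) (i : 'I_n) : 0 < a -> a <= 1 ->
  \sum_(X | good a X) code_mass a X * fresh_prob Mg a i X
  <= 2 * expR (- (a * d%:R / (64 * n%:R ^+ 2))) * \sum_(X : code) code_mass a X.
Proof.
move=> a0 a1; set K := 2 * _.
have p2 : 0 < 2 ^+ d :> R by rewrite exprn_gt0.
rewrite big_mkcond /= -(ler_pM2l p2) mulrCA -!(sum_setrow i) mulr_sumr.
apply: ler_sum => X _.
(* Goodness depends on the resampled row as well, hence it enters through the weights. *)
pose w (b : {ffun 'I_d -> bool}) :=
  if good a (setrow i b X) then code_mass a (setrow i b X) else 0.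
rewrite (eq_bigr (fun b => w b * fine (Mg (code_mx (blank i X))
    (traced a i (setrow i b X) : set (vecB d))))); last first.
  move=> b _; rewrite /w /fresh_prob /blank setrow_setrow.
  by case: ifP => // _; rewrite mul0r.
apply: weighted_prob_le => [b|b|y].
- exact: measurable_traced.
- by rewrite /w; case: ifP => // _; exact: code_mass_ge0.
- have := score_tail a i X (clipv y) a0 a1 (fun j => norm_clip_le1 _ _).
  apply: le_trans; apply: ler_sum => b _; rewrite /w indicE.
  have -> : (y \in (traced a i (setrow i b X) : set (vecB d))) =
      (a * d%:R <= `|code_score a i (setrow i b X) (clipv y)|).
    by apply/idP/idP => [/set_mem|h] //; apply/mem_set.
  by case: ifP => gX; rewrite ?mul0r //= mulr0.
Qed.

Lemma estimator_traced (lam beta a : R) (M : mechanism n d) (X : code) :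
  leq 1 n -> leq 1 d -> 1 <= lam -> 0 < beta -> a = (256 * lam ^+ 2)^-1 ->
  outputs_on_sphere M -> top_sv_estimator lam beta M ->
  diff_private 1 (beta / (4 * n%:R)) (M (4 * lam)^-1) ->
  good a X ->
  3 / 4 * beta <= expR 1 * \sum_i fresh_prob (M (4 * lam)^-1) a i X.
Proof.
move=> n0 d0 lam1 b0 aE onS est dp gX.
have lam0 : 0 < lam by lra.
have n1 : 0 < n%:R :> R by rewrite ltr0n.
set g := (4 * lam)^-1.
have g0 : 0 < g by rewrite invr_gt0 mulr_gt0.
(* This [g] turns the accuracy loss into [n / 4], the amount [accurate_traced] tolerates. *)
have lg : lam * g = 1 / 4 by rewrite /g; field; rewrite gt_eqF.
have g4 : g <= 1 / 4 by have := ler_wpM2r (ltW g0) lam1; lra.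
have g1 : g <= 1 by lra.
have g2 : g ^+ 2 = 16 * a by rewrite aE /g; field; rewrite gt_eqF.
have a0 : 0 < a by rewrite aE invr_gt0 mulr_gt0 // exprn_gt0.
have a1 : a <= 1 / 256.
  have : g * g <= 1 / 4 * (1 / 4) by apply: ler_pM => //; exact: ltW.
  by rewrite -expr2 g2; lra.
have dX := dataset_code_mx X d0.
have [v tv] := top_right_sv_exists _ _ (code_mx X) d0.
have gap : singular_value (code_mx X) 2 <= g * singular_value (code_mx X) 1.
  (* Since [g ^+ 2 = 16 * a], the gap condition reads [8 * a <= 16 * a * (1 - 8 * a)]. *)
  pose e := 4 * a; apply: (singular_gap _ _ _ e); rewrite /e //.
  - by apply/andP; split; lra.
  - exact: ltW.
  - rewrite g2; have : a * a <= a * (1 / 256) by rewrite ler_pM2l.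
    lra.
  - exact: good_gram.
have g01 : 0 <= g <= 1 by rewrite ltW.
set P := M g (code_mx X).
pose A : set 'rV[R]_d :=
  [set y | sqnormXy (code_mx X) v - 1 / 4 * n%:R <= sqnormXy (code_mx X) y]%classic.
have bA : (beta%:E <= P (A : set (vecB d)))%E.
  apply: (le_trans (est _ _ _ dX g01 gap tv)).
  rewrite le_eqVlt; apply/orP; left; apply/eqP; congr (P _).
  by apply/seteqP; split=> y; rewrite /A /= RminusE !RmultE lg => /RleP.
pose T (i : 'I_n) : set (vecB d) := traced a i X.
have mA : measurable (A : set (vecB d)).
  apply: closed_measurable_vecB.
  apply: (@preimage_closed _ _ (fun y : 'rV[R]_d => sqnormXy (code_mx X) y)
    [set x | sqnormXy (code_mx X) v - 1 / 4 * n%:R <= x]%classic);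
    last exact: closed_ge.
  by move=> y _; exact: continuous_sqnormXy.
have mS : measurable (sphere d : set (vecB d)).
  by apply: closed_measurable_vecB; exact: closed_sphere.
have bA' : beta <= fine (P A) by rewrite -lee_fin fineK // fin_num_measure.
have bnd : fine (P A) <= \sum_i fine (P (T i)).
  apply: (@prob_le_sum _ _ _ P _ A (sphere d : set (vecB d))) => //.
  - by move=> i; exact: measurable_traced.
  - exact: onS.
  - move=> y yA yS; apply: (accurate_traced a X v y) => //.
    by apply: le_trans a1 _; lra.
have delta0 : 0 <= beta / (4 * n%:R) by rewrite divr_ge0 ?mulr_ge0 // ltW.
have : \sum_i fine (P (T i)) <=
    \sum_i (expR 1 * fresh_prob (M g) a i X + beta / (4 * n%:R)).
  by apply: ler_sum => i _; exact: private_traced.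
rewrite big_split /= -mulr_sumr sumr_const card_ord -[X in _ + X]mulr_natr.
(* The additive privacy losses of all rows together cost a quarter of [beta]. *)
have -> : beta / (4 * n%:R) * n%:R = beta / 4 by field; rewrite gt_eqF.
lra.
Qed.
End tracing.

(** * The exponential inequality and the resulting sample size *)

(** Average the per-code bound over good codes; their mass is at least half of the total, which
    turns [3 / 4] into [3 / 8]. *)
Lemma fingerprinting_bound (n d : nat) (lam beta a : R) (M : mechanism n d) :
  leq 1 n -> leq 1 d -> 1 <= lam -> 0 < beta -> a = (256 * lam ^+ 2)^-1 ->
  outputs_on_sphere M -> top_sv_estimator lam beta M ->
  diff_private 1 (beta / (4 * n%:R)) (M (4 * lam)^-1) ->
  3 / 8 * beta
  <= 2 * expR 1 * n%:R * expR (- (a * d%:R / (64 * n%:R ^+ 2))).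
Proof.
move=> n0 d0 lam1 b0 aE onS est dp.
have lam0 : 0 < lam by lra.
have a0 : 0 < a by rewrite aE invr_gt0 mulr_gt0 // exprn_gt0.
have a1 : a <= 1.
  rewrite aE invf_le1 ?mulr_gt0 ?exprn_gt0 //.
  by have := exprn_ege1 2 lam1; lra.
have Z0 : 0 < \sum_(X : @code n d) code_mass a X := sum_code_mass_gt0 a a0.
have Zg : \sum_(X : @code n d) code_mass a X
    <= 2 * \sum_(X : @code n d | good a X) code_mass a X := good_mass a a0 n0 d0.
set K := expR (- _).
have step : 3 / 4 * beta * \sum_(X : @code n d | good a X) code_mass a X <=
    expR 1 * \sum_(i < n) \sum_(X : @code n d | good a X)
      code_mass a X * fresh_prob (M (4 * lam)^-1) a i X.
  rewrite exchange_big /= mulr_sumr mulr_sumr; apply: ler_sum => X gX.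
  rewrite -mulr_sumr mulrCA mulrC ler_wpM2l ?code_mass_ge0 //.
  exact: (estimator_traced lam).
have : \sum_(i < n) \sum_(X : @code n d | good a X)
      code_mass a X * fresh_prob (M (4 * lam)^-1) a i X <=
    n%:R * (2 * K * \sum_(X : @code n d) code_mass a X).
  have -> : n%:R * (2 * K * \sum_(X : @code n d) code_mass a X) =
      \sum_(i < n) (2 * K * \sum_(X : @code n d) code_mass a X).
    by rewrite sumr_const card_ord mulr_natl.
  by apply: ler_sum => i _; exact: fresh_prob_mean.
move=> /(ler_wpM2l (expR_ge0 1)) => /(le_trans step) h.
rewrite -(ler_pM2r Z0).
have := ler_wpM2l (ltW b0) Zg => h2.
have -> : 2 * expR 1 * n%:R * K * \sum_(X : @code n d) code_mass a X =
   expR 1 * (n%:R * (2 * K * \sum_(X : @code n d) code_mass a X)) by ring.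
apply: le_trans h; move: h2.
set Z := \sum_(X : @code n d) code_mass a X.
set Zg' := \sum_(X | _) _; lra.
Qed.

(** If [N] were smaller, the exponential would be at most [x ^- 6], while [N <= beta * x]; with
    [x >= 2] this contradicts the hypothesis. *)
Lemma sample_size_of_exp_bound (F : realType) (N D lam beta : F) :
  0 < N -> 1 <= D -> 1 <= lam -> 0 < beta -> 2 <= D / (beta * lam) ->
  3 / 8 * beta
  <= 2 * expR 1 * N * expR (- ((256 * lam ^+ 2)^-1 * D / (64 * N ^+ 2))) ->
  1 / (32 * 32) * ((Num.sqrt D / lam) / (ln (D / (beta * lam)) `^ (3 / 2))) <= N.
Proof.
move=> N0 D1 lam1 b0; set x := D / _; set L := ln x => x2 H.
have lam0 : 0 < lam by lra.
have D0 : 0 < D by lra.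
have ehalf : expR (1 / 2) <= 2 :> F.
  have := @expR_le_quadratic F (1 / 2) (lexx _); rewrite expr2; lra.
have e4 : expR 1 <= 4 :> F.
  have -> : expR 1 = expR (1 / 2) * expR (1 / 2) :> F.
    by rewrite -exp.expRD; congr expR; lra.
  have -> : 4 = 2 * 2 :> F by ring.
  by apply: ler_pM; rewrite ?expR_ge0.
have x0 : 0 < x by lra.
have eL : expR L = x by rewrite lnK // posrE.
have L2 : 1 / 2 <= L by rewrite -ler_expR eL; lra.
set p := L `^ (3 / 2).
have p0 : 0 < p by apply: powR_gt0; lra.
have p2 : p ^+ 2 = L ^+ 3.
  by rewrite /p -powR_mulrn ?powR_ge0 // -powRrM -powR_mulrn; [congr (_ `^ _)|]; lra.
rewrite leNgt; apply/negP => small.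
have sD : 32 * 32 * (N * lam * p) < Num.sqrt D.
  move: small; have -> : 1 / (32 * 32) * ((Num.sqrt D / lam) / p) =
    Num.sqrt D / (32 * 32 * (lam * p)) by field; rewrite !gt_eqF.
  rewrite ltr_pdivlMr ?mulr_gt0 //; apply: le_lt_trans.
  by rewrite le_eqVlt; apply/orP; left; apply/eqP; ring.
have big : (32 * 32 * 32 * 32) * ((N * lam) ^+ 2 * L ^+ 3) < D.
  rewrite -[ltRHS](sqr_sqrtr (ltW D0)) -p2.
  have -> : (32 * 32 * 32 * 32) * ((N * lam) ^+ 2 * p ^+ 2) = (32 * 32 * (N * lam * p)) ^+ 2 by ring.
  by rewrite ltr_pXn2r // ?nnegrE ?sqrtr_ge0 // !mulr_ge0 // ltW.
(* The cube comes from squaring the power [3 / 2] in the bound; only a linear term in [L] is kept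
   for the exponent. *)
have L3 : L / 4 <= L ^+ 3.
  have -> : L / 4 = L * (1 / 2 * (1 / 2)) by field.
  by rewrite exprS expr2 ler_pM2l ?ler_pM //; lra.
have NL : 0 < (N * lam) ^+ 2 by rewrite exprn_gt0 // mulr_gt0.
have NlD : N * lam <= D.
  have : (N * lam) ^+ 2 <= D ^+ 2.
    have h1 : (N * lam) ^+ 2 * (1 / 8) <= (N * lam) ^+ 2 * L ^+ 3.
      by rewrite ler_pM2l //; lra.
    have h2 : D <= D ^+ 2 by rewrite expr2 ler_peMl // ltW.
    lra.
  by rewrite ler_pXn2r // nnegrE ltW // mulr_gt0.
have u6 : 6 * L <= (256 * lam ^+ 2)^-1 * D / (64 * N ^+ 2).
  have -> : (256 * lam ^+ 2)^-1 * D / (64 * N ^+ 2) = D / ((256 * 64) * (N * lam) ^+ 2).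
    by field; rewrite !gt_eqF.
  rewrite ler_pdivlMr ?mulr_gt0 //.
  have := ler_wpM2l (ltW NL) L3; lra.
have e6 : expR (- ((256 * lam ^+ 2)^-1 * D / (64 * N ^+ 2))) * x ^+ 6 <= 1.
  rewrite -eL -expRM_natl -exp.expRD -[leRHS](@exp.expR0 F) ler_expR; lra.
have x6 : 0 < x ^+ 6 by rewrite exprn_gt0.
have := ler_wpM2r (ltW x6) H.
set Ex := expR (- _) in e6 *.
have h1 : 2 * expR 1 * N * Ex * x ^+ 6 <= 8 * N.
  have -> : 2 * expR 1 * N * Ex * x ^+ 6 = 2 * expR 1 * N * (Ex * x ^+ 6) by ring.
  apply: (@le_trans _ _ (2 * expR 1 * N)).
    by apply: ler_piMr e6; rewrite !mulr_ge0 ?expR_ge0 // ltW.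
  by rewrite ler_pM2r //; lra.
move=> /le_trans /(_ h1) h2.
have Nx : N <= beta * x.
  have -> : beta * x = D / lam by rewrite /x; field; rewrite !gt_eqF.
  by rewrite ler_pdivlMr.
(* One factor [x] is spent on [N <= beta * x]; the other five give [3 / 8 * 32 = 12], which exceeds
   8. *)
have x5 : 32 <= x ^+ 5.
  have -> : 32 = 2 ^+ 5 :> F by ring.
  by rewrite ler_pXn2r // nnegrE //; lra.
have bx : 0 < beta * x by rewrite mulr_gt0.
have h3 : beta * x * 32 <= beta * x * x ^+ 5 by rewrite ler_pM2l.
have h4 : 3 / 8 * beta * x ^+ 6 = 3 / 8 * (beta * x * x ^+ 5) by ring.
rewrite h4 in h2; lra.
Qed.

Theorem theorem1p18 :
  exists c : R, 0 < c /\
  forall (n d : nat) (lam beta : R) (M : mechanism n d),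
    leq 1 n -> 1 <= lam -> 0 < beta <= 1 ->
    2 <= d%:R / (beta * lam) ->
    outputs_on_sphere M ->
    top_sv_estimator lam beta M ->
    (forall g : R, 0 <= g <= 1 -> diff_private 1 (beta / (4 * n%:R)) (M g)) ->
    c * ((Num.sqrt d%:R / lam) / (ln (d%:R / (beta * lam)) `^ (3 / 2))) <= n%:R.
Proof.
exists (1 / (32 * 32)); split; first by lra.
move=> n d lam beta M n0 lam1 /andP[b0 b1] x2 onS est dp.
(* For [d = 0] the ratio in [x2] would be 0. *)
have d0 : leq 1 d.
  by move: x2; case: d {M onS est dp} => //; rewrite mul0r leNgt ltr0n.
apply: sample_size_of_exp_bound => //; rewrite ?ltr0n ?ler1n //.
apply: (fingerprinting_bound n d lam beta _ M) => //; apply: dp.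
rewrite invr_ge0 invf_le1 ?mulr_gt0 //; last by lra.
by apply/andP; split; lra.
Qed.
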